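(* Let $\mathcal{N}$ be a qubit channel (a CPTP map from operators on $\mathbb{C}^2$ to operators on $\mathbb{C}^2$) and let $A$ be the $3\times3$ correlation matrix of its Choi matrix $J_{\mathcal{N}}$, i.e. $A_{ij}=\frac12\mathrm{Tr}[(\sigma_i\otimes\sigma_j)J_{\mathcal{N}}]$ where $\sigma_1,\sigma_2,\sigma_3$ are the Pauli matrices. Then $$\mathrm{cv}(\mathcal{N})=1+\sigma_{\max}(A),$$ where $\sigma_{\max}(A)$ is the largest singular value of $A$.
   Context: The Choi matrix of $\mathcal{N}$ is $J_{\mathcal{N}}=\sum_{i,j}|i\rangle\langle j|\otimes\mathcal{N}(|i\rangle\langle j|)$. Communication value: for a classical channel with transition probabilities $P(y|x)$, $x\in[n]$, $y\in[n']$, put $\mathrm{cv}(\mathbf{P})=\sum_{y\in[n']}\max_{x\in[n]}P(y|x)$. For a quantum channel, $\mathrm{cv}(\mathcal{N})$ is the supremum, over all $n,n'\in\mathbb{N}$, all density operators $\rho_1,\dots,\rho_n$ on the input space and all POVMs $\{\Pi_y\}_{y=1}^{n'}$ on the output space, of $\mathrm{cv}(\mathbf{P})$ with $P(y|x)=\mathrm{Tr}[\Pi_y\mathcal{N}(\rho_x)]$. *)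

(* Defs.v *)
From HB Require Import structures.
From mathcomp Require Import all_boot all_order all_algebra.
From mathcomp Require Import complex mxtens.
From mathcomp Require Import all_classical all_reals.
Set Implicit Arguments.
Unset Strict Implicit.
Unset Printing Implicit Defensive.
Import Order.TTheory GRing.Theory Num.Theory.
Local Open Scope classical_set_scope.
Local Open Scope ring_scope.
Local Open Scope sesquilinear_scope.

(* In R[i], [0 <= z] means that z is real and nonnegative; in particular a
   positive semidefinite matrix is Hermitian. *)
Definition psd (R : realType) (n : nat) (M : 'M[R[i]]_n) : Prop :=
  forall v : 'cV[R[i]]_n, 0 <= (v ^t* *m M *m v) 0 0.

Definition density (R : realType) (n : nat) (rho : 'M[R[i]]_n) : Prop :=
  psd rho /\ \tr rho = 1.

Definition povm (R : realType) (n m : nat) (Pi : 'I_m -> 'M[R[i]]_n) : Prop :=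
  (forall y, psd (Pi y)) /\ \sum_(y < m) Pi y = 1%:M.

(* The (i, j) block of X, when X is seen as a k x k matrix of d x d blocks:
   X = \sum_(i, j) delta_mx i j *t tens_block X i j. *)
Definition tens_block (R : realType) (k d : nat) (X : 'M[R[i]]_(k * d))
    (i j : 'I_k) : 'M[R[i]]_d :=
  \matrix_(a < d, b < d) X (mxtens_index (i, a)) (mxtens_index (j, b)).

(* id_k (x) N *)
Definition ampliation (R : realType) (d e k : nat)
    (N : 'M[R[i]]_d -> 'M[R[i]]_e) (X : 'M[R[i]]_(k * d)) : 'M[R[i]]_(k * e) :=
  \sum_(i < k) \sum_(j < k) (delta_mx i j : 'M[R[i]]_k) *t N (tens_block X i j).

Definition completely_positive (R : realType) (d e : nat)
    (N : 'M[R[i]]_d -> 'M[R[i]]_e) : Prop :=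
  forall (k : nat) (X : 'M[R[i]]_(k * d)), psd X -> psd (ampliation N X).

Definition trace_preserving (R : realType) (d e : nat)
    (N : 'M[R[i]]_d -> 'M[R[i]]_e) : Prop :=
  forall X : 'M[R[i]]_d, \tr (N X) = \tr X.

Definition channel (R : realType) (d e : nat)
    (N : {linear 'M[R[i]]_d -> 'M[R[i]]_e}) : Prop :=
  completely_positive N /\ trace_preserving N.

Definition choi (R : realType) (d e : nat) (N : 'M[R[i]]_d -> 'M[R[i]]_e) :
    'M[R[i]]_(d * e) :=
  \sum_(i < d) \sum_(j < d) (delta_mx i j : 'M[R[i]]_d) *t N (delta_mx i j).

(* [P x y] stands for P(y|x); the input alphabet is nonempty, so that the
   maximum exists. *)
Definition classical_cv (R : realType) (n m : nat)
    (P : 'I_n.+1 -> 'I_m -> R) : R :=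
  \sum_(y < m) \big[Num.max/P ord0 y]_(x < n.+1) P x y.

(* For a channel N, states rho and a POVM Pi the traces are real, and taking
   the real part only casts them from R[i] to R. *)
Definition induced_channel (R : realType) (d e n m : nat)
    (N : 'M[R[i]]_d -> 'M[R[i]]_e)
    (rho : 'I_n.+1 -> 'M[R[i]]_d) (Pi : 'I_m -> 'M[R[i]]_e)
    (x : 'I_n.+1) (y : 'I_m) : R :=
  complex.Re (\tr (Pi y *m N (rho x))).

(* For a channel on spaces of dimensions d, e > 0 this set is nonempty and
   bounded above by e. *)
Definition cv (R : realType) (d e : nat)
    (N : {linear 'M[R[i]]_d -> 'M[R[i]]_e}) : R :=
  sup [set r : R | exists (n m : nat) (rho : 'I_n.+1 -> 'M[R[i]]_d)
                     (Pi : 'I_m -> 'M[R[i]]_e),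
         [/\ forall x, density (rho x), povm Pi
           & r = classical_cv (induced_channel N rho Pi)]].

Definition pauli_x (R : realType) : 'M[R[i]]_2 := delta_mx 0 1 + delta_mx 1 0.
Definition pauli_y (R : realType) : 'M[R[i]]_2 :=
  ('i%C : R[i]) *: (delta_mx 1 0 - delta_mx 0 1).
Definition pauli_z (R : realType) : 'M[R[i]]_2 := delta_mx 0 0 - delta_mx 1 1.
Definition pauli (R : realType) (k : 'I_3) : 'M[R[i]]_2 :=
  tnth [tuple pauli_x R; pauli_y R; pauli_z R] k.

(* The entries are real when J is Hermitian; they are kept in R[i]. *)
Definition correlation_mx (R : realType) (J : 'M[R[i]]_(2 * 2)) : 'M[R[i]]_3 :=
  \matrix_(i < 3, j < 3) (2^-1 * \tr ((pauli R i *t pauli R j) *m J)).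

Definition singular_value (R : realType) (m n : nat) (A : 'M[R[i]]_(m, n))
    (s : R) : Prop :=
  0 <= s /\ eigenvalue (A ^t* *m A) ((s ^+ 2)%:C)%C.

(* The set of singular values is finite, and nonempty for n > 0, so that this
   supremum is a maximum. *)
Definition sigma_max (R : realType) (m n : nat) (A : 'M[R[i]]_(m, n)) : R :=
  sup [set s : R | singular_value A s].

(* Main.v *)
Require Import Defs.
From HB Require Import structures.
From mathcomp Require Import all_boot all_order all_algebra.
From mathcomp Require Import complex mxtens.
From mathcomp Require Import all_classical all_reals.
From mathcomp Require Import ring.
Import Order.TTheory GRing.Theory Num.Theory.
Local Open Scope ring_scope.

(* The Choi matrix pairs sigma_i with N(sigma_i^T), so A_ij is
   Tr[sigma_j N(sigma_i^T)] / 2, and inputs are written (1 + r.sigma)^T / 2 with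
   |r| <= 1.  A POVM element is p + q.sigma with |q| <= p, and trace preservation
   gives
     Tr[(p + q.sigma) N(rho)] = Tr[(p + q.sigma) N(1)] / 2 + r A q^T.
   Summing over a POVM, the first terms add up to Tr[N(1)] / 2 = 1, and the
   second ones to at most sigma_max(A) since the p's add up to 1.  Equality is
   reached by the two antipodal pure states v, -v measured along u, -u, where
   u and v are unit vectors with v A u^T = sigma_max(A). *)

Set Implicit Arguments.
Unset Strict Implicit.

Section Qubit.
Local Open Scope sesquilinear_scope.
Context {R : realType}.
Local Notation C := R[i].
Local Notation toC := (map_mx (real_complex R)).

(** * Positive semidefinite matrices and positive maps *)

Lemma conjCE (z : C) : z^* = conjc z.
Proof. by []. Qed.

Lemma psd_congr m n (X : 'M[C]_(m, n)) (M : 'M[C]_n) :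
  psd M -> psd (X *m M *m X ^t*).
Proof.
move=> hM v; have := hM (X ^t* *m v).
by rewrite trmx_mul map_mxM /= trmxCK !mulmxA.
Qed.

(** The quadratic form of the transpose at [v] is that of [M] at the conjugate of [v]. *)
Lemma psd_tr n (M : 'M[C]_n) : psd M -> psd M^T.
Proof.
move=> hM v; have := hM (map_mx Num.conj v).
have -> : (map_mx Num.conj v) ^t* = v^T.
  by apply/matrixP => i j; rewrite !mxE conjCK.
have -> : v ^t* *m M^T *m v = (v^T *m M *m map_mx Num.conj v)^T.
  by rewrite !trmx_mul trmxK map_trmx mulmxA.
by move=> h; rewrite mxE.
Qed.

Lemma psd_diag_ge0 n (M : 'M[C]_n) i : psd M -> 0 <= M i i.
Proof.
move=> /(_ (delta_mx i 0)); rewrite -mulmxA -colE mxE (bigD1 i) //=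
  big1 ?addr0; last first.
  by move=> j /negPf ji; rewrite !mxE ji conjC0 mul0r.
by rewrite !mxE !eqxx conjC1 mul1r.
Qed.

Lemma psd_mxtrace_ge0 n (M : 'M[C]_n) : psd M -> 0 <= \tr M.
Proof. by move=> hM; apply: sumr_ge0 => i _; apply: psd_diag_ge0. Qed.

(** By cyclicity the trace is that of the compression [P M P^*], which is positive semidefinite. *)
Lemma psd_mxtrace_mul n (P M : 'M[C]_n) :
  P ^t* = P -> P *m P = P -> psd M -> 0 <= \tr (P *m M).
Proof.
move=> PC PP hM; rewrite -PP -mulmxA mxtrace_mulC -{2}PC.
exact/psd_mxtrace_ge0/psd_congr.
Qed.

Lemma psd1 n : psd (1%:M : 'M[C]_n).
Proof.
move=> v; rewrite mulmx1 mxE; apply: sumr_ge0 => i _.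
by rewrite !mxE mulrC mul_conjC_ge0.
Qed.

Lemma psd_proj n (P : 'M[C]_n) : P ^t* = P -> P *m P = P -> psd P.
Proof.
move=> PC PP; rewrite -PP -{2}PC -[P in P *m _]mulmx1.
exact/psd_congr/psd1.
Qed.

(** Selecting rows and columns along [f] is a congruence by a 0/1 matrix, whether or not [f] is
    injective. *)
Lemma psd_mxsub m n (f : 'I_m -> 'I_n) (M : 'M[C]_n) :
  psd M -> psd (mxsub f f M).
Proof.
move=> hM; have -> : mxsub f f M = rowsub f 1%:M *m M *m (rowsub f 1%:M) ^t*.
  rewrite -rowsubE; apply/matrixP => i j; rewrite !mxE (bigD1 (f j)) //= big1; last first.
    by move=> k kj; rewrite !mxE eq_sym (negPf kj) conjC0 mulr0.
  by rewrite !mxE eqxx conjC1 mulr1 addr0.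
exact: psd_congr.
Qed.

Lemma completely_positive_psd d e (N : 'M[C]_d -> 'M[C]_e) M :
  completely_positive N -> psd M -> psd (N M).
Proof.
(* Complete positivity with k = 1, up to reindexing 'I_(1 * d) by 'I_d. *)
move=> cpN hM.
have := cpN _ _ (psd_mxsub (fun k => (@mxtens_unindex 1 d k).2) hM).
move/(psd_mxsub (fun a : 'I_e => @mxtens_index 1 e (0, a))).
congr psd; apply/matrixP=> a b; rewrite mxE /ampliation !big_ord1 tensmxE mxE !eqxx mul1r.
congr (N _ a b); apply/matrixP => i j.
by rewrite !mxE !mxtens_indexK.
Qed.

(** * Pauli coordinates of 2 x 2 matrices *)

Definition dot n (u v : 'rV[R]_n) : R := \sum_k u 0 k * v 0 k.

Definition bloch (q : 'rV[R]_3) : 'M[C]_2 :=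
  \sum_k (q 0 k)%:C%C *: pauli R k.

Lemma sum_ord2 (V : nmodType) (F : 'I_2 -> V) : \sum_i F i = F 0 + F 1.
Proof. by rewrite big_ord_recl big_ord1; congr (_ + F _); apply: val_inj. Qed.

Lemma sum_ord3 (V : nmodType) (F : 'I_3 -> V) :
  \sum_i F i = F 0 + F 1 + F ord_max.
Proof.
rewrite !big_ord_recl big_ord0 addr0 addrA.
by congr (_ + F _ + F _); apply: val_inj.
Qed.

Lemma eq_mx2 (A B : 'M[C]_2) : A 0 0 = B 0 0 -> A 0 1 = B 0 1 ->
  A 1 0 = B 1 0 -> A 1 1 = B 1 1 -> A = B.
Proof.
have ord2 (i : 'I_2) : i = 0 \/ i = 1.
  by case: i => -[|[|//]] ?; [left|right]; apply: val_inj.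
by move=> ? ? ? ?; apply/matrixP => i j; case: (ord2 i) => ->; case: (ord2 j) => ->.
Qed.

(** A product of equations instead of a conjunction, so that [rewrite] takes it as a multirule. *)
Lemma bloch_entries (q : 'rV[R]_3) :
  ((bloch q 0 0 = Complex (q 0 ord_max) 0) *
  (bloch q 0 1 = Complex (q 0 0) (- q 0 1)) *
  (bloch q 1 0 = Complex (q 0 0) (q 0 1)) *
  (bloch q 1 1 = Complex (- q 0 ord_max) 0))%type.
Proof.
rewrite /bloch sum_ord3 /pauli !(tnth_nth 0) /=.
rewrite /pauli_x /pauli_y /pauli_z.
split; [split; [split|]|]; rewrite !mxE /=; simpc; congr Complex; ring.
Qed.

Lemma dot3 (u v : 'rV[R]_3) :
  dot u v = u 0 0 * v 0 0 + u 0 1 * v 0 1 + u 0 ord_max * v 0 ord_max.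
Proof. by rewrite /dot sum_ord3. Qed.

Lemma dotE n (u v : 'rV[R]_n) : dot u v = (u *m v^T) 0 0.
Proof. by rewrite mxE; apply: eq_bigr => k _; rewrite mxE. Qed.

Lemma dot_delta n (k : 'I_n) : dot (delta_mx 0 k : 'rV[R]_n) (delta_mx 0 k) = 1.
Proof. by rewrite dotE trmx_delta mul_delta_mx mxE !eqxx. Qed.

Lemma bloch_adj (q : 'rV[R]_3) : (bloch q) ^t* = bloch q.
Proof.
by apply: eq_mx2; rewrite !mxE !bloch_entries conjCE /= ?oppr0 ?opprK.
Qed.

Lemma bloch_sqr (q : 'rV[R]_3) : bloch q *m bloch q = ((dot q q)%:C%C)%:M.
Proof.
by apply: eq_mx2; rewrite !mxE !sum_ord2 !bloch_entries dot3 /=; simpc;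
  congr Complex; ring.
Qed.

Lemma mxtrace_bloch (q : 'rV[R]_3) : \tr (bloch q) = 0.
Proof.
rewrite /mxtrace sum_ord2 !bloch_entries; simpc.
by rewrite -[RHS]/(Complex 0 0); congr Complex; ring.
Qed.

Lemma mxtrace_bloch_mul (p q : 'rV[R]_3) :
  \tr (bloch p *m bloch q) = 2 * (dot p q)%:C%C.
Proof.
rewrite /mxtrace sum_ord2 !mxE !sum_ord2 !bloch_entries dot3.
by simpc; congr Complex; ring.
Qed.

Lemma pauli_bloch k : pauli R k = bloch (delta_mx 0 k).
Proof.
rewrite /bloch (bigD1 k) //= big1; last first.
  by move=> j /negPf jk; rewrite mxE jk andbF scale0r.
by rewrite mxE !eqxx scale1r addr0.
Qed.

Lemma complex_half : 2^-1 = (2^-1)%:C%C :> C.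
Proof. by rewrite fmorphV rmorph_nat. Qed.

(** The identity and the Pauli matrices are an orthogonal basis for the trace pairing, each of
    squared norm 2. *)
Lemma pauli_decomposition (M : 'M[C]_2) :
  M = (2^-1 * \tr M)%:M + \sum_k (2^-1 * \tr (pauli R k *m M)) *: pauli R k.
Proof.
rewrite complex_half sum_ord3 /mxtrace !sum_ord2 !pauli_bloch.
apply: eq_mx2; rewrite !mxE !sum_ord2 !bloch_entries !mxE /=.
all: move: (M 0 0) (M 0 1) (M 1 0) (M 1 1) => [a b] [c d] [e f] [g h].
all: rewrite ?mulr1n ?mulr0n; apply/eqP; rewrite eq_complex /=.
all: by apply/andP; split; apply/eqP; field.
Qed.

(** * Pure states, and positivity in Bloch coordinates *)

Definition bloch_state (q : 'rV[R]_3) : 'M[C]_2 := 2^-1 *: (1%:M + bloch q).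

Lemma bloch_state_adj q : (bloch_state q) ^t* = bloch_state q.
Proof.
apply/matrixP => i j; have /matrixP/(_ i j) := bloch_adj q.
rewrite !mxE => e; rewrite rmorphM rmorphD /= e conjC_nat eq_sym; congr (_ * _).
by rewrite fmorphV rmorph_nat.
Qed.

(** For a unit vector, [bloch q] squares to 1, so [1 + bloch q] squares to twice itself. *)
Lemma bloch_state_idem q : dot q q = 1 -> bloch_state q *m bloch_state q = bloch_state q.
Proof.
move=> q1; rewrite /bloch_state -scalemxAl -scalemxAr mulmxDl !mulmxDr !mul1mx mulmx1.
rewrite bloch_sqr q1 (_ : 1%:C%C%:M = 1%:M) // [bloch q + _]addrC -mulr2n.
by rewrite -[X in _ *: (_ *: X)]scaler_nat !scalerA; congr (_ *: _); field.
Qed.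

Lemma psd_bloch_state q : dot q q = 1 -> psd (bloch_state q).
Proof.
by move=> q1; apply: psd_proj; [exact: bloch_state_adj | exact: bloch_state_idem].
Qed.

Lemma mxtrace_bloch_state_mul q (M : 'M[C]_2) :
  \tr (bloch_state q *m M) = 2^-1 * (\tr M + \tr (bloch q *m M)).
Proof. by rewrite -scalemxAl mxtraceZ mulmxDl mul1mx mxtraceD. Qed.

Lemma mxtrace_bloch_state q : \tr (bloch_state q) = 1.
Proof.
rewrite -[bloch_state q]mulmx1 mxtrace_bloch_state_mul mulmx1 mxtrace_bloch.
by rewrite mxtrace1 addr0 mulVf ?pnatr_eq0.
Qed.

Lemma bloch_state_mxtrace_ge0 q (M : 'M[C]_2) : dot q q = 1 -> psd M ->
  0 <= \tr M + \tr (bloch q *m M).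
Proof.
move=> q1 hM; have := psd_mxtrace_mul (bloch_state_adj q) (bloch_state_idem q1) hM.
by rewrite mxtrace_bloch_state_mul pmulr_rge0 ?invr_gt0 ?ltr0n.
Qed.

Lemma dotZ n (a b : R) (u v : 'rV[R]_n) : dot (a *: u) (b *: v) = a * b * dot u v.
Proof. by rewrite /dot mulr_sumr; apply: eq_bigr => k _; rewrite !mxE mulrACA. Qed.

Lemma dot_ge0 n (u : 'rV[R]_n) : 0 <= dot u u.
Proof. by apply: sumr_ge0 => k _; rewrite -expr2 sqr_ge0. Qed.

Lemma dot_eq0 n (u : 'rV[R]_n) : (dot u u == 0) = (u == 0).
Proof.
apply/idP/eqP => [|->]; last by rewrite /dot big1 // => k _; rewrite mxE mul0r.
rewrite psumr_eq0 => [/allP h|k _]; last by rewrite -expr2 sqr_ge0.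
apply/rowP => k; have := h k; rewrite mem_index_enum /= mulf_eq0 orbb mxE.
by move=> /(_ isT)/eqP.
Qed.

Lemma dot_unit n (u : 'rV[R]_n) : u != 0 ->
  dot ((Num.sqrt (dot u u))^-1 *: u) ((Num.sqrt (dot u u))^-1 *: u) = 1.
Proof.
rewrite -dot_eq0 => u0; rewrite dotZ -invfM -expr2 sqr_sqrtr ?dot_ge0 //.
by rewrite mulVf.
Qed.

(** The trace is a difference of two nonnegative numbers: the pairing of [M] with [1 + pauli R k],
    and the trace of [M]. *)
Lemma psd_mxtrace_pauli_real k (M : 'M[C]_2) :
  psd M -> \tr (pauli R k *m M) \is Num.real.
Proof.
move=> hM; have trM := psd_mxtrace_ge0 hM.
have d1 := dot_delta k.
have := bloch_state_mxtrace_ge0 d1 hM; rewrite -pauli_bloch => /ger0_real h.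
by rewrite -[\tr (_ *m _)](addKr (\tr M)) realD // realN ger0_real.
Qed.

Lemma psd_bloch_coords (M : 'M[C]_2) : psd M ->
  exists2 p : R, 0 <= p & exists2 q : 'rV[R]_3, dot q q <= p ^+ 2 &
  M = (p%:C%C)%:M + bloch q.
Proof.
move=> hM; have trM := psd_mxtrace_ge0 hM.
have hk k := psd_mxtrace_pauli_real k hM.
pose p := complex.Re (2^-1 * \tr M).
pose q := \row_k complex.Re (2^-1 * \tr (pauli R k *m M)).
have half_real : 2^-1 \is @Num.real C by rewrite realV realn.
have t0 : 0 <= 2^-1 * \tr M by rewrite mulr_ge0 // invr_ge0 ler0n.
have pE : p%:C%C = 2^-1 * \tr M by rewrite RRe_real // ger0_real.
have p0 : 0 <= p by rewrite -ler0c pE.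
have eM : M = (p%:C%C)%:M + bloch q.
  rewrite {1}[M]pauli_decomposition pE; congr (_ + _).
  by apply: eq_bigr => k _; rewrite mxE RRe_real // realM.
exists p => //; exists q => //.
have [->|q0] := eqVneq q 0.
  by rewrite /dot big1 ?sqr_ge0 // => k _; rewrite mxE mul0r.
set s := Num.sqrt (dot q q).
have s0 : 0 < s by rewrite sqrtr_gt0 lt_neqAle dot_ge0 eq_sym dot_eq0 q0.
have ds : dot q q = s ^+ 2 by rewrite sqr_sqrtr ?dot_ge0.
(* The pure state antipodal to [q] is the sharpest test: positivity against it says 2(p - |q|) >=
   0. *)
have d1 : dot (- s^-1 *: q) (- s^-1 *: q) = 1 by rewrite dotZ mulrNN -dotZ dot_unit.
have := bloch_state_mxtrace_ge0 d1 hM.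
rewrite eM mulmxDr !mxtraceD mxtrace_bloch mxtrace_bloch_mul mul_mx_scalar.
rewrite mxtraceZ mxtrace_bloch.
rewrite mxtrace_scalar mulr0 addr0 add0r -[q in dot _ q]scale1r dotZ ds mulr1.
have -> : - s^-1 * s ^+ 2 = - s by field; rewrite gt_eqF.
rewrite -[_ *+ 2]mulr_natl -mulrDr pmulr_rge0 ?ltr0n // -rmorphD /= ler0c subr_ge0 => sp.
by rewrite lerXn2r ?nnegrE // ltW.
Qed.

(** * Largest singular value of a real matrix *)

Lemma toC_adj m n (A : 'M[R]_(m, n)) : (toC A) ^t* = toC A^T.
Proof. by apply/matrixP => i j; rewrite !mxE conjCE conjc_real. Qed.

(** The spectral theorem is applied to the complexified Gram matrix; its spectrum is real, and [l]
    is the largest element. *)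
Lemma gram_max_eigenvalue m n (B : 'M[R]_(m, n.+1)) :
  exists2 l : R, eigenvalue (B^T *m B) l &
    forall u : 'rV[R]_n.+1, dot (u *m B^T) (u *m B^T) <= l * dot u u.
Proof.
set G := toC (B^T *m B).
have GH : G \is hermsymmx.
  apply/is_hermitianmxP; rewrite expr0 scale1r toC_adj.
  by rewrite trmx_mul trmxK.
have Dreal i : spectral_diag G 0 i \is Num.real.
  by have /mxOverP -> := hermitian_spectral_diag_real GH.
have /orthomx_spectralP := hermitian_normalmx GH.
set P := spectralmx G in Dreal *; set D := spectral_diag G in Dreal * => GE.
have Pu : P \is unitarymx := spectral_unitarymx G.
have PG : P *m G = diag_mx D *m P.
  by rewrite {1}GE !mulmxA mulmxV ?mul1mx // unitarymx_unit.
pose d i := complex.Re (D 0 i).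
have dE i : D 0 i = (d i)%:C%C by rewrite RRe_real.
pose i0 := [arg max_(i > ord0) d i]%O.
have dmax i : d i <= d i0 by rewrite /i0; case: arg_maxP => // j _; apply.
exists (d i0).
  rewrite -(eigenvalue_map (real_complex R)) -[map_mx _ _]/G.
  apply/eigenvalueP; exists (row i0 P).
    by rewrite -row_mul PG row_mul row_diag_mx -scalemxAl -rowE dE.
  (* A row of a unitary matrix has norm 1, hence is a genuine eigenvector. *)
  apply/eqP => P0; have /unitarymxP/matrixP/(_ i0 i0) := Pu.
  have -> : (P *m P ^t*) i0 i0 = (row i0 P *m P ^t*) 0 i0.
    by rewrite -row_mul [RHS]mxE.
  by rewrite P0 mul0mx !mxE eqxx => /eqP; rewrite eq_sym oner_eq0.
move=> u; rewrite -lecR.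
(* The coordinates of [u] in the eigenbasis: both sides of the bound become weighted sums of the
   |y_i|^2. *)
pose y := toC u *m P ^t*.
have sqE k (z : 'rV[C]_k) : (z *m z ^t*) 0 0 = \sum_i `|z 0 i| ^+ 2.
  by rewrite mxE; apply: eq_bigr => i _; rewrite !mxE normCK.
have uE : toC u = y *m P by rewrite mulmxKtV.
have uaE : toC u^T = P ^t* *m y ^t*.
  by rewrite -toC_adj uE trmx_mul map_mxM.
have toC00 (M : 'M[R]_1) : (M 0 0)%:C%C = (toC M) 0 0 by rewrite mxE.
have PPa : P *m P ^t* = 1%:M by apply/unitarymxP.
have -> : (dot (u *m B^T) (u *m B^T))%:C%C = \sum_i D 0 i * `|y 0 i| ^+ 2.
  rewrite dotE toC00 trmx_mul trmxK -mulmxA (mulmxA B^T) map_mxM map_mxM -/G /=.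
  rewrite uE uaE !mulmxA -(mulmxA _ P) PG !mulmxA.
  rewrite -(mulmxA _ P) PPa mulmx1 mxE; apply: eq_bigr => i _.
  by rewrite mul_mx_diag !mxE normCK mulrAC mulrA mulrC mulrA.
rewrite [leRHS]rmorphM /=.
have -> : (dot u u)%:C%C = \sum_i `|y 0 i| ^+ 2.
  by rewrite dotE toC00 map_mxM /= uE uaE !mulmxA -(mulmxA _ P) PPa mulmx1 sqE.
rewrite mulr_sumr; apply: ler_sum => i _.
by rewrite dE ler_wpM2r ?exprn_ge0 // lecR.
Qed.

(** For [v] nonzero, the squared norm of (v.v)u - (u.v)v is v.v times the difference of the two
    sides. *)
Lemma dot_cauchy_schwarz n (u v : 'rV[R]_n) :
  dot u v ^+ 2 <= dot u u * dot v v.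
Proof.
have h (w : 'rV[R]_n) a b : w = a *: u - b *: v ->
    dot w w = a ^+ 2 * dot u u - a * b * dot u v *+ 2 + b ^+ 2 * dot v v.
  move=> ->; rewrite /dot !mulr_sumr -sumrMnl -sumrB -big_split /=.
  by apply: eq_bigr => k _; rewrite !mxE; ring.
have [->|v0] := eqVneq v 0.
  by rewrite {1}/dot big1 ?expr0n ?mulr_ge0 ?dot_ge0 // => k _; rewrite mxE mulr0.
have dv : 0 < dot v v by rewrite lt_neqAle dot_ge0 eq_sym dot_eq0 v0.
have := dot_ge0 (dot v v *: u - dot u v *: v); rewrite (h _ _ _ erefl).
rewrite (_ : _ + _ = dot v v * (dot u u * dot v v - dot u v ^+ 2)); last by ring.
by rewrite pmulr_rge0 // subr_ge0.
Qed.

Lemma singular_value_real m n (B : 'M[R]_(m, n)) s :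
  singular_value (toC B) s <-> 0 <= s /\ eigenvalue (B^T *m B) (s ^+ 2).
Proof.
by rewrite /singular_value toC_adj -map_mxM (eigenvalue_map (real_complex R)).
Qed.

(** This turns the supremum of singular values into an attained bound on the bilinear form v B u^T.
    Its square is the top eigenvalue of the Gram matrix, the bound is Cauchy-Schwarz, and a unit top
    eigenvector [u] attains it. *)
Lemma sigma_max_real m n (B : 'M[R]_(m.+1, n.+1)) (s := sigma_max (toC B)) :
  [/\ 0 <= s,
      forall v u, dot (v *m B) u ^+ 2 <= s ^+ 2 * (dot v v * dot u u) &
      exists v u, [/\ dot v v = 1, dot u u = 1 & dot (v *m B) u = s]].
Proof.
have [l /eigenvalueP[w wB w0] lmax] := gram_max_eigenvalue B.
have dw : 0 < dot w w by rewrite lt_neqAle dot_ge0 eq_sym dot_eq0 w0.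
have BE x : dot (x *m B^T) (x *m B^T) = dot (x *m (B^T *m B)) x.
  by rewrite !dotE trmx_mul trmxK !mulmxA.
have l0 : 0 <= l.
  have := dot_ge0 (w *m B^T).
  by rewrite BE wB -[w in dot _ w]scale1r dotZ mulr1 pmulr_lge0.
have lsv : singular_value (toC B) (Num.sqrt l).
  apply/singular_value_real; rewrite sqrtr_ge0 sqr_sqrtr //.
  by split => //; apply/eigenvalueP; exists w.
(* An eigenvector [x] for t^2 satisfies t^2 |x|^2 = |x B^T|^2 <= l |x|^2. *)
have lub t : singular_value (toC B) t -> t <= Num.sqrt l.
  move=> /singular_value_real[t0 /eigenvalueP[x xB x0]].
  have dx : 0 < dot x x by rewrite lt_neqAle dot_ge0 eq_sym dot_eq0 x0.
  rewrite -[t]ger0_norm // -sqrtr_sqr ler_wsqrtr // -(ler_pM2r dx).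
  by have := lmax x; rewrite BE xB -{2}[x]scale1r dotZ mulr1.
have sE : s = Num.sqrt l.
  apply/eqP; rewrite eq_le ge_sup ?ub_le_sup //=; last by exists (Num.sqrt l).
  by exists (Num.sqrt l).
have s0 : 0 <= s by rewrite sE sqrtr_ge0.
have s2 : s ^+ 2 = l by rewrite sE sqr_sqrtr.
have dotB v u : dot (v *m B) u = dot v (u *m B^T).
  by rewrite !dotE trmx_mul trmxK mulmxA.
have bound v u : dot (v *m B) u ^+ 2 <= s ^+ 2 * (dot v v * dot u u).
  rewrite dotB (le_trans (dot_cauchy_schwarz _ _)) // mulrCA ler_wpM2l ?dot_ge0 //.
  by rewrite s2.
split => //.
pose u := (Num.sqrt (dot w w))^-1 *: w.
have u1 : dot u u = 1 := dot_unit w0.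
have uB : u *m (B^T *m B) = s ^+ 2 *: u.
  by rewrite -scalemxAl wB s2 !scalerA mulrC.
have [sz|sn0] := eqVneq s 0.
  exists (delta_mx 0 0), u.
  have v1 := dot_delta (0 : 'I_m.+1).
  split=> //; have := bound (delta_mx 0 0) u.
  by rewrite v1 u1 sz expr0n mul0r real_exprn_even_le0 ?num_real //= => /eqP.
exists (s^-1 *: (u *m B^T)), u; split => //.
  by rewrite dotZ BE uB -[u in dot _ u]scale1r dotZ u1 !mulr1; field.
rewrite -scalemxAl -mulmxA uB scalerA -[u in dot _ u]scale1r dotZ u1 !mulr1.
by field.
Qed.

(** * The Choi matrix and Bloch vectors of input states *)

Lemma mxtrace_tens m n (A : 'M[C]_m) (B : 'M[C]_n) :
  \tr (A *t B) = \tr A * \tr B.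
Proof. by rewrite /mxtrace mulr_sum; apply: eq_bigr => i _; rewrite mxE. Qed.

(** Since Tr[S |i><j|] = S_ji, the first tensor factor weights N(|i><j|) by the entries of the
    transpose of [S]. *)
Lemma mxtrace_tens_choi d e (N : {linear 'M[C]_d -> 'M[C]_e}) S T :
  \tr ((S *t T) *m choi N) = \tr (T *m N S^T).
Proof.
have -> : N S^T = \sum_i \sum_j S^T i j *: N (delta_mx i j).
  rewrite {1}[S^T]matrix_sum_delta linear_sum; apply: eq_bigr => i _.
  by rewrite linear_sum; apply: eq_bigr => j _; rewrite linearZ.
rewrite /choi !mulmx_sumr !raddf_sum; apply: eq_bigr => i _.
rewrite !mulmx_sumr !raddf_sum; apply: eq_bigr => j _.
rewrite /= tensmx_mul mxtrace_tens -scalemxAr mxtraceZ.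
congr (_ * _); rewrite mxE /mxtrace (bigD1 j) //= big1 ?addr0; last first.
  move=> k kj; rewrite mxE big1 // => l _.
  by rewrite !mxE (negPf kj) andbF mulr0.
rewrite mxE (bigD1 i) //= big1 ?addr0; last first.
  by move=> k ki; rewrite !mxE (negPf ki) mulr0.
by rewrite !mxE !eqxx mulr1.
Qed.

Lemma correlation_choiE (N : {linear 'M[C]_2 -> 'M[C]_2}) k j :
  correlation_mx (choi N) k j = 2^-1 * \tr (pauli R j *m N (pauli R k)^T).
Proof. by rewrite mxE mxtrace_tens_choi. Qed.

Lemma blochZ a (q : 'rV[R]_3) : bloch (a *: q) = a%:C%C *: bloch q.
Proof. by rewrite scaler_sumr; apply: eq_bigr => k _; rewrite mxE rmorphM scalerA. Qed.

Lemma density_bloch (rho : 'M[C]_2) : density rho ->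
  exists2 r : 'rV[R]_3, dot r r <= 1 & rho = (bloch_state r)^T.
Proof.
move=> [/psd_tr/psd_bloch_coords[p p0 [q qp rhoE]] tr1].
have p2 : p = 2^-1.
  move: tr1; rewrite -mxtrace_tr rhoE mxtraceD mxtrace_bloch addr0 mxtrace_scalar.
  move=> /(congr1 (@complex.Re R)); rewrite raddfMn /= => e.
  by rewrite -[p]mulr1 -[X in _ * X](@mulfV _ 2) ?pnatr_eq0 // mulrA mulr_natr e mul1r.
(* Unit trace forces p = 1/2, so |q| <= 1/2 and the Bloch vector is twice [q]. *)
exists (2 *: q).
  by rewrite dotZ -expr2 -ler_pdivlMl ?exprn_gt0 ?ltr0n // mulr1 -exprVn -p2.
rewrite -[rho]trmxK rhoE /bloch_state scalerDr scalemx1 blochZ scalerA p2.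
congr (_ + _)^T.
  by rewrite complex_half.
by rewrite rmorph_nat mulVf ?pnatr_eq0 // scale1r.
Qed.

Lemma density_bloch_state_tr (r : 'rV[R]_3) :
  dot r r = 1 -> density (bloch_state r)^T.
Proof.
move=> r1; split; first exact/psd_tr/psd_bloch_state.
by rewrite mxtrace_tr mxtrace_bloch_state.
Qed.

(** * Upper and lower bounds for a qubit channel *)

Section Channel.
Context (N : {linear 'M[C]_2 -> 'M[C]_2}) (hN : channel N).

(** A Pauli matrix is twice a pure state minus the identity. The channel keeps both positive, also
    after transposition, and positive matrices pair with Pauli matrices to real numbers. *)
Lemma correlation_choi_real : exists B, correlation_mx (choi N) = toC B.
Proof.
exists (\matrix_(k, j) complex.Re (correlation_mx (choi N) k j)).
apply/matrixP => k j; rewrite [RHS]mxE [in RHS]mxE RRe_real // correlation_choiE.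
have d1 := dot_delta k.
have psdN M : psd M -> psd (N M) by apply: completely_positive_psd; case: hN.
have -> : pauli R k = 2 *: bloch_state (delta_mx 0 k) - 1%:M.
  by rewrite scalerA mulfV ?pnatr_eq0 // scale1r -pauli_bloch addrC addKr.
rewrite linearB linearZ linearB linearZ mulmxBr -scalemxAr mxtraceD mxtraceZ raddfN /=.
rewrite trmx1 realM ?realV ?realn // realD ?realN // ?realM ?realn //.
  exact/psd_mxtrace_pauli_real/psdN/psd_tr/psd_bloch_state.
exact/psd_mxtrace_pauli_real/psdN/psd1.
Qed.

(** By trace preservation each N(sigma_k^T) is traceless, so [p] meets only N(1); the other pairings
    Tr[sigma_j N(sigma_k^T)] are 2 B_kj. *)
Lemma mxtrace_mul_channel B p (q r : 'rV[R]_3) : correlation_mx (choi N) = toC B ->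
  \tr ((p%:M + bloch q) *m N (bloch_state r)^T) =
  2^-1 * \tr ((p%:M + bloch q) *m N 1%:M) + (dot (r *m B) q)%:C%C.
Proof.
move=> AB; set P := _ + _.
have NE : N (bloch r)^T = \sum_k (r 0 k)%:C%C *: N (pauli R k)^T.
  rewrite /bloch !linear_sum; apply: eq_bigr => k _.
  by rewrite !linearZ.
have -> : N (bloch_state r)^T = 2^-1 *: (N 1%:M + N (bloch r)^T).
  have -> : (bloch_state r)^T = 2^-1 *: (1%:M + (bloch r)^T).
    by rewrite linearZ linearD /= trmx1.
  by rewrite linearZ linearD.
have trP k : \tr (P *m N (pauli R k)^T) = 2 * \sum_j (B k j * q 0 j)%:C%C.
  rewrite mulmxDl mul_scalar_mx mxtraceD mxtraceZ (proj2 hN) mxtrace_tr pauli_bloch.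
  rewrite mxtrace_bloch mulr0 add0r -pauli_bloch mulmx_suml raddf_sum mulr_sumr.
  apply: eq_bigr => j _; rewrite /= -scalemxAl mxtraceZ rmorphM /=.
  have := correlation_choiE N k j; rewrite AB mxE => ->.
  by field.
rewrite -scalemxAr mxtraceZ mulmxDr mxtraceD mulrDr; congr (_ + _).
rewrite NE mulmx_sumr raddf_sum mulr_sumr /=.
under eq_bigr => k _ do
  rewrite -scalemxAr mxtraceZ trP mulrCA mulKf ?pnatr_eq0 // mulr_sumr.
rewrite exchange_big /dot rmorph_sum; apply: eq_bigr => j _ /=.
rewrite mxE mulr_suml rmorph_sum; apply: eq_bigr => k _ /=.
by rewrite -rmorphM mulrA.
Qed.

(** The right-hand side is independent of [rho], so it bounds the maximum over inputs, and it is
    additive in [P], so it can be summed over a POVM. *)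
Lemma mxtrace_mul_channel_le B s (P rho : 'M[C]_2) :
    correlation_mx (choi N) = toC B -> 0 <= s ->
    (forall v u, dot (v *m B) u ^+ 2 <= s ^+ 2 * (dot v v * dot u u)) ->
    psd P -> density rho ->
  complex.Re (\tr (P *m N rho)) <=
  complex.Re (2^-1 * \tr (P *m N 1%:M)) + s * complex.Re (2^-1 * \tr P).
Proof.
move=> AB s0 Bs /psd_bloch_coords[p p0 [q qp PE]] /density_bloch[r r1 ->].
have -> : complex.Re (2^-1 * \tr P) = p.
  rewrite PE mxtraceD mxtrace_bloch addr0 mxtrace_scalar -[p%:C%C *+ 2]mulr_natl.
  by rewrite mulKf ?pnatr_eq0.
rewrite {1}PE (mxtrace_mul_channel _ _ _ AB) -PE raddfD lerD2l /=.
rewrite (le_trans (ler_norm _)) // -[leRHS]ger0_norm ?mulr_ge0 //.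
(* After squaring: (r B q^T)^2 <= s^2 |r|^2 |q|^2 <= s^2 p^2. *)
rewrite -ler_sqr ?nnegrE // !real_normK ?num_real // exprMn (le_trans (Bs _ _)) //.
by rewrite ler_wpM2l ?sqr_ge0 // -[leRHS]mul1r ler_pM ?dot_ge0.
Qed.

Lemma classical_cv_le s n m (rho : 'I_n.+1 -> 'M[C]_2) (Pi : 'I_m -> 'M[C]_2) B :
    correlation_mx (choi N) = toC B -> 0 <= s ->
    (forall v u, dot (v *m B) u ^+ 2 <= s ^+ 2 * (dot v v * dot u u)) ->
    (forall x, density (rho x)) -> povm Pi ->
  classical_cv (induced_channel N rho Pi) <= 1 + s.
Proof.
move=> AB s0 Bs hrho [hPi Pi1].
have half_tr (M : 'M[C]_2) : \tr M = 2 -> complex.Re (2^-1 * \tr M) = 1.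
  by move=> ->; rewrite mulVf ?pnatr_eq0.
have ub y x := mxtrace_mul_channel_le AB s0 Bs (hPi y) (hrho x).
apply: (@le_trans _ _ (\sum_y (complex.Re (2^-1 * \tr (Pi y *m N 1%:M)) +
    s * complex.Re (2^-1 * \tr (Pi y))))).
  (* The default value of the maximum is the term of input [ord0], so the same bound covers it. *)
  by apply: ler_sum => y _; apply: bigmax_le => [|x _]; apply: ub.
rewrite big_split /= -mulr_sumr -!raddf_sum /= -!mulr_sumr -!raddf_sum /=.
rewrite -mulmx_suml Pi1 mul1mx.
by rewrite !half_tr ?mulr1 ?(proj2 hN) ?mxtrace1.
Qed.

Lemma classical_cv_attained s B v u :
    correlation_mx (choi N) = toC B ->
    dot v v = 1 -> dot u u = 1 -> dot (v *m B) u = s ->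
  exists (rho : 'I_2 -> 'M[C]_2) (Pi : 'I_2 -> 'M[C]_2),
    [/\ forall x, density (rho x), povm Pi
      & 1 + s <= classical_cv (induced_channel N rho Pi)].
Proof.
move=> AB v1 u1 vu.
(* The signs +1 and -1 give the antipodal vectors for both the states and the measurement. *)
pose sg (x : 'I_2) : R := (-1) ^+ x.
have sg2 x : sg x * sg x = 1 by rewrite -expr2 sqrr_sign.
have sgu x n (w : 'rV[R]_n) : dot w w = 1 -> dot (sg x *: w) (sg x *: w) = 1.
  by move=> w1; rewrite dotZ sg2 mul1r.
pose Pi x := bloch_state (sg x *: u).
have Pi1 : \sum_y Pi y = 1%:M.
  rewrite sum_ord2 /Pi -scalerDr !blochZ addrACA /sg /= expr0 expr1.
  rewrite rmorphN rmorph1 scaleN1r scale1r subrr addr0 -mulr2n.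
  by rewrite -[1%:M *+ 2]scaler_nat scalerA mulVf ?pnatr_eq0 // scale1r.
exists (fun x => (bloch_state (sg x *: v))^T), Pi; split.
- by move=> x; apply/density_bloch_state_tr/sgu.
- by split => // y; apply/psd_bloch_state/sgu.
rewrite /classical_cv.
apply: (@le_trans _ _ (\sum_y (complex.Re (2^-1 * \tr (Pi y *m N 1%:M)) + 2^-1 * s))).
  rewrite big_split /= sumr_const card_ord -raddf_sum -mulr_sumr -raddf_sum.
  rewrite -mulmx_suml Pi1 mul1mx /= (proj2 hN) mxtrace1 mulVf ?pnatr_eq0 //.
  by rewrite -[X in _ <= _ + X]mulr_natl mulVKf ?pnatr_eq0.
(* The maximum is bounded below by the matching input x = y, where the two signs cancel and leave
   s/2. *)
apply: ler_sum => y _; apply: le_trans (le_bigmax _ _ y).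
rewrite /induced_channel.
have PiE : Pi y = 2^-1%:M + bloch ((2^-1 * sg y) *: u).
  by rewrite -scalerA blochZ -complex_half -scalemx1 -scalerDr.
rewrite {2}PiE (mxtrace_mul_channel _ _ _ AB) -PiE raddfD lerD2l /=.
by rewrite -scalemxAl dotZ vu mulrCA sg2 mulr1.
Qed.
End Channel.
End Qubit.

Unset Implicit Arguments.
Set Strict Implicit.

Theorem theorem2 (R : realType) (N : {linear 'M[R[i]]_2 -> 'M[R[i]]_2})
    (hN : channel N) :
  cv N = 1 + sigma_max (correlation_mx (choi N)).
Proof.
have [B AB] := correlation_choi_real hN; rewrite AB.
have [s0 Bs [v [u [v1 u1 vu]]]] := sigma_max_real B.
have [rho [Pi [hrho hPi lb]]] := classical_cv_attained hN AB v1 u1 vu.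
apply/eqP; rewrite eq_le; apply/andP; split.
  apply: ge_sup.
    (* The input alphabet is ['I_n.+1], so n = 1 stands for two inputs. *)
    by exists (classical_cv (induced_channel N rho Pi)), 1%N, 2%N, rho, Pi.
  by move=> _ [n [m [rho' [Pi' [? ? ->]]]]]; apply: classical_cv_le AB s0 Bs _ _.
apply: le_trans lb _; apply: ub_le_sup; last by exists 1%N, 2%N, rho, Pi.
(* Comparing an element with [sup] requires the set to be bounded above; the upper estimate supplies
   this too. *)
exists (1 + sigma_max (map_mx (real_complex R) B)) => _ [n [m [rho' [Pi' [? ? ->]]]]].
exact: classical_cv_le AB s0 Bs _ _.
Qed.
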